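(* Let $(\mathbf u_k)_{k=1}^\infty$ be a sequence of elements of $c_{00}(\mathbb Q)$ which lists every element of $c_{00}(\mathbb Q)$ infinitely many times, and let $(a_k)_{k=1}^\infty$ be a strictly increasing sequence of positive integers such that, for every $k$ with $\mathbf u_k\neq 0$, $a_k>\max\operatorname{supp}\mathbf u_k$ and $a_k\ge\|\mathbf u_k\|_1$. Define the norm $\|\cdot\|$ on the real space $c_0$ by $$\|\mathbf x\|=\|\mathbf x\|_0+\sum_{k=1}^\infty 2^{-a_k^2}\,\bigl|\langle \mathbf x,\mathbf u_k-e_{a_k}\rangle\bigr|.$$ Then the Banach space $(c_0,\|\cdot\|)$ has no proximinal subspace $H$ of finite codimension $n\ge 2$.
   Context: All spaces are over $\mathbb R$, and sequences are indexed by $\mathbb N=\{1,2,\dots\}$. $c_{00}(\mathbb Q)$ is the countable set of finitely supported sequences with rational entries; $\operatorname{supp}\mathbf u$ is the set of indices of nonzero entries of $\mathbf u$; $\|\mathbf u\|_1$ is the $\ell^1$ norm; $\|\mathbf x\|_0=\sup_n|x_n|$ is the usual norm on $c_0$; $e_j$ are the unit vectors; $\langle\cdot,\cdot\rangle$ is the $\langle c_0,\ell^1\rangle$ duality $\langle \mathbf x,\mathbf y\rangle=\sum_n x_ny_n$ (so $c_{00}(\mathbb Q)\subset\ell^1$). The norm $\|\cdot\|$ is finite and equivalent to $\|\cdot\|_0$. A nonempty subset $E$ of a metric space is proximinal if for every point $x\notin E$ there is $e\in E$ with $d(x,e)=d(x,E)=\inf_{y\in E}d(x,y)$. Subspace means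 linear subspace; a proximinal subspace is necessarily closed. *)

(* Defs.v *)
From HB Require Import structures.
From mathcomp Require Import all_boot all_order all_algebra.
From mathcomp Require Import finmap.
From mathcomp Require Import all_classical all_reals all_analysis.

Set Implicit Arguments.
Unset Strict Implicit.
Unset Printing Implicit Defensive.

Import Order.TTheory GRing.Theory Num.Theory.
Import numFieldNormedType.Exports.

Local Open Scope classical_set_scope.
Local Open Scope ring_scope.

(* Sequences (x_1, x_2, ...) are functions on nat in which [x n] is the entry
   of index n.+1.  Indices themselves (the a_k, the elements of a support) keep
   their 1-based value, since it matters in 2^(-a_k^2) and in the comparison
   of a_k with max supp u_k. *)

Section C0.
Variable R : realType.

Definition c0_pred : {pred nat -> R} := mem [set x : nat -> R | x @ \oo --> 0].

Lemma c0_pred_submod : submod_closed c0_pred.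
Proof.
split; first by rewrite inE /=; exact: cvg_cst.
move=> a x y; rewrite !inE /= => x0 y0.
rewrite -[X in _ --> X](addr0 (0 : R)); apply: cvgD => //.
by rewrite -[X in _ --> X](mulr0 a); apply: cvgMr.
Qed.

HB.instance Definition _ :=
  GRing.isSubmodClosed.Build R (nat -> R) c0_pred c0_pred_submod.

Record c0 : Type := C0 { c0_seq :> nat -> R; _ : c0_seq \in c0_pred }.

HB.instance Definition _ := [isSub for c0_seq].
HB.instance Definition _ := [Choice of c0 by <:].
HB.instance Definition _ := [SubChoice_isSubZmodule of c0 by <:].
HB.instance Definition _ := [SubZmodule_isSubLmodule of c0 by <:].

Definition sup_norm (x : nat -> R) : R := sup (range (fun n => `|x n|)).

Definition l1_norm (y : nat -> R) : R := limn [series `|y n|]_n.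

Definition pairing (x y : nat -> R) : R := limn [series x n * y n]_n.

(* The unit vector e_j, for j >= 1. *)
Definition unit_vec (j : nat) : nat -> R := fun n => (n.+1 == j)%:R.

End C0.

Definition c00Q := {fsfun nat -> rat with 0}.

Definition seq_of_c00Q (R : realType) (v : c00Q) : nat -> R :=
  fun n => ratr (v n).

Definition max_supp (v : c00Q) : nat := (\max_(n <- finsupp v) n.+1)%N.

(* k ranges over {0, 1, ...} instead of {1, 2, ...}; the value of k plays no
   role. *)
Definition read_norm (R : realType) (u : nat -> c00Q) (a : nat -> nat)
    (x : nat -> R) : R :=
  sup_norm x +
  limn [series
    2 ^- (a k ^ 2) *
      `|pairing x (seq_of_c00Q R (u k) - unit_vec R (a k))|]_k.

Definition proximinal (R : realType) (T : Type) (d : T -> T -> R)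
    (E : set T) : Prop :=
  E !=set0 /\
  forall x, ~ E x -> exists2 e, E e & d x e = inf [set d x y | y in E].

Definition linear_subspace (R : realType) (V : lmodType R) (H : set V) : Prop :=
  submod_closed (mem H).

(* The classes of b_0, ..., b_(n-1) form a basis of the quotient V / H. *)
Definition has_codim (R : realType) (V : lmodType R) (H : set V) (n : nat) :
    Prop :=
  exists b : 'I_n -> V, forall x : V,
    exists! c : 'rV[R]_n, H (x - \sum_(i < n) c 0 i *: b i).

(* Main.v *)
Require Import Defs.
From mathcomp Require Import all_boot all_order all_algebra.
From mathcomp Require Import finmap.
From mathcomp Require Import all_classical all_reals all_analysis.
From mathcomp Require Import ring lra zify.
Set Implicit Arguments.
Unset Strict Implicit.
Unset Printing Implicit Defensive.
Import Order.TTheory GRing.Theory Num.Theory numFieldNormedType.Exports.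
Local Open Scope classical_set_scope.
Local Open Scope ring_scope.

(** Write N for the norm of the theorem, v_k = u_k - e_(a_k) and
    c_k = 2^(-a_k^2), so that N x = sup_norm x + sum_k c_k |<x, v_k>|.

    Proximinality of a subspace H of finite codimension forces every linear
    functional f vanishing on H to attain its norm on the unit sphere of N:
    f factors through the finite-dimensional quotient by H, it attains its norm
    there by compactness, and a nearest point lifts the maximiser to a unit
    vector ([proximinal_attains_norm]).  So it suffices to show that norm
    attaining functionals do not fill a two-dimensional space.

    A functional f of norm M that attains its norm at x is visible in its
    values on the vectors e_(a_j) for large j.  Moving x along e_(a_j) by a small
    s does not increase the sup norm, because x tends to 0; it increases the
    summands k > j of N by at most |s| c_j / 4 in all, because a_k^2 grows fast;
    and it changes the summand j by - s c_j sg <x, v_j>.  As N cannot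
    grow slower than f / M, this gives
      |f(e_(a_j)) + M c_j sg <x, v_j>| <= M c_j / 4
    ([norming_coordinate]).  Each w in c00(Q) is u_j for arbitrarily large j,
    and then <x, v_j> = <x, w> - x_(a_j) has the sign of <x, w>
    ([norming_coordinate_near]).

    Suppose that f and g have norm 1, attained at x and x', and that f + g has
    norm M, attained at x''.  If x and x' were linearly independent, some w
    would have <x, w> > 0 and <x', w> > 0, and some other one <x, w> > 0 and
    <x', w> < 0, both with <x'', w> <> 0.  Up to the errors above, the first
    one says M = 2 and the second one M = 0, which is absurd
    ([norming_points_proportional]).

    Finally, let f <> 0 vanish on H and attain its norm at x.  As the
    codimension is at least 2, some g <> 0 vanishing on H has g x = 0; it
    attains its norm at a multiple of x, where it vanishes: a contradiction. *)

(** * Norm-attaining functionals and proximinal subspaces *)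

(** For a norm N and a linear f, the operator norm of f is then f x. *)
Definition attains_norm (R : realType) (V : lmodType R) (N f : V -> R)
    (x : V) :=
  N x = 1 /\ forall z, f z <= f x * N z.

Lemma scalar_at0 (R : realType) (V : lmodType R) (f : V -> R) :
  scalar f -> f 0 = 0.
Proof.
by move=> fl; have := fl (-1) 0 0; rewrite scaler0 addr0 mulN1r addNr.
Qed.

Lemma scalar_scale (R : realType) (V : lmodType R) (f : V -> R) t x :
  scalar f -> f (t *: x) = t * f x.
Proof.
by move=> fl; have := fl t x 0; rewrite !addr0 (scalar_at0 fl) addr0.
Qed.

Lemma linear_subspaceP (R : realType) (V : lmodType R) (H : set V) :
  linear_subspace H -> H 0 /\ forall t x y, H x -> H y -> H (t *: x + y).
Proof.
move=> [/set_mem H0 Hlin]; split => // t x y Hx Hy.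
by apply: set_mem; apply: Hlin; apply: mem_set.
Qed.

Lemma lipschitz_continuous_real (R : realType) (V : normedModType R)
    (F : V -> R) (K : R) :
  (forall c d, `|F c - F d| <= K * `|c - d|) -> continuous F.
Proof.
move=> FK c; apply/cvgrPdist_lt => e e0.
have K0 : 0 < Num.max K 1 by rewrite lt_max ltr01 orbT.
near=> d.
apply: le_lt_trans (FK c d) _.
apply: (@le_lt_trans _ _ (Num.max K 1 * `|c - d|)).
  by rewrite ler_wpM2r// le_max lexx.
rewrite mulrC -ltr_pdivlMr//.
by near: d; apply: cvgr_dist_lt => //; exact: divr_gt0.
Unshelve. all: by end_near. Qed.

Lemma ler_coord_norm (R : realType) n (c : 'rV[R]_n) i : `|c 0 i| <= `|c|.
Proof.
rewrite [leRHS]/Num.norm /= mx_normrE; apply/bigmax_geP; right => /=.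
by exists (0, i).
Qed.

Lemma coordinate_functional (R : realType) (V : lmodType R) (H : set V) n
    (b : 'I_n -> V) (i : 'I_n) :
  linear_subspace H ->
  (forall x, exists! c : 'rV[R]_n, H (x - \sum_(j < n) c 0 j *: b j)) ->
  exists f : V -> R, [/\ scalar f, (forall h, H h -> f h = 0)
    & forall j, f (b j) = (j == i)%:R].
Proof.
move=> /linear_subspaceP[H0 Hlin] bH.
pose c x := projT1 (cid (bH x)).
have cH x : H (x - \sum_(j < n) c x 0 j *: b j).
  by rewrite /c; case: cid => /= ? [].
have c_uniq x (d : 'rV_n) : H (x - \sum_(j < n) d 0 j *: b j) -> c x = d.
  by rewrite /c; case: cid => /= e [_]; apply.
exists (fun x => c x 0 i); split.
- move=> t x y; rewrite (c_uniq _ (t *: c x + c y)) ?mxE//.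
  rewrite (_ : _ - _ = t *: (x - \sum_(j < n) c x 0 j *: b j) +
                     (y - \sum_(j < n) c y 0 j *: b j)); first exact: Hlin.
  rewrite scalerBr addrACA -opprD scaler_sumr -big_split /=.
  congr (_ - _); apply: eq_bigr => j _.
  by rewrite !mxE scalerDl scalerA.
- move=> h Hh; rewrite (c_uniq _ 0) ?mxE// big1 ?subr0// => j _.
  by rewrite mxE scale0r.
- move=> j; rewrite (c_uniq _ (delta_mx 0 j)); first by rewrite mxE eqxx eq_sym.
  rewrite (bigD1 j)//= mxE !eqxx scale1r big1 ?addr0 ?subrr// => k kj.
  by rewrite mxE eqxx /= (negbTE kj) scale0r.
Qed.


Section proximinal_finite_codim.
Variables (R : realType) (V : lmodType R) (N : V -> R).
Hypothesis N_triangle : forall x y, N (x + y) <= N x + N y.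
Hypothesis N_scale : forall t x, N (t *: x) = `|t| * N x.
Hypothesis N_eq0 : forall x, N x = 0 -> x = 0.

Let N0 : N 0 = 0. Proof. by rewrite -(scale0r 0) N_scale normr0 mul0r. Qed.
Let N_opp x : N (- x) = N x.
Proof. by rewrite -scaleN1r N_scale normrN1 mul1r. Qed.
Let N_ge0 x : 0 <= N x.
Proof.
have := N_triangle x (- x); rewrite subrr N0 N_opp -mulr2n -mulr_natl => h.
by rewrite pmulr_rge0 in h.
Qed.

Lemma attains_norm_ge0 (f : V -> R) x :
  scalar f -> attains_norm N f x -> 0 <= f x.
Proof.
move=> fl [Nx /(_ (-1 *: x))].
by rewrite scalar_scale// N_scale normrN1 Nx; lra.
Qed.

Lemma attains_norm_gt0 (f : V -> R) x y :
  scalar f -> attains_norm N f x -> f y != 0 -> 0 < f x.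
Proof.
move=> fl fx fy; rewrite lt_neqAle eq_sym (attains_norm_ge0 fl fx) andbT.
apply: contraNneq fy => fx0; have [_ fN] := fx.
have := fN y; have := fN (-1 *: y).
by rewrite scalar_scale// fx0 !mul0r eq_le; lra.
Qed.

(** Let q be the quotient norm on V / H, identified with row vectors through
    the basis.  A maximiser c of f / q on the unit sphere of the sup norm exists
    by compactness: q is Lipschitz, and it does not vanish on the sphere because
    a distance 0 to H is attained only by elements of H.  Subtracting from the
    vector with coordinates c its nearest point in H, and normalising, gives a
    unit vector at which f attains its norm. *)
Lemma proximinal_attains_norm (H : set V) n (b : 'I_n.+1 -> V) (f : V -> R) :
  linear_subspace H ->
  (forall x, exists! c : 'rV[R]_n.+1, H (x - \sum_(i < n.+1) c 0 i *: b i)) ->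
  proximinal (fun x y => N (x - y)) H ->
  scalar f -> (forall h, H h -> f h = 0) ->
  exists x, attains_norm N f x.
Proof.
move=> /linear_subspaceP[H0 Hlin] bH [_ prox] flin fH.
have HZ t x : H x -> H (t *: x).
  by move=> Hx; rewrite -[_ *: _]addr0; exact: Hlin.
pose L (c : 'rV[R]_n.+1) : V := \sum_(i < n.+1) c 0 i *: b i.
have LD c d : L (c + d) = L c + L d.
  by rewrite /L -big_split /=; apply: eq_bigr => i _; rewrite mxE scalerDl.
have LZ t c : L (t *: c) = t *: L c.
  by rewrite /L scaler_sumr; apply: eq_bigr => i _; rewrite mxE scalerA.
have LB c d : L (c - d) = L c - L d by rewrite LD -(scaleN1r d) LZ scaleN1r.
have L_inj c : H (L c) -> c = 0.
  move=> HLc; have [e [_ e_uniq]] := bH (L c).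
  rewrite -(e_uniq c) ?subrr//; apply: e_uniq.
  by rewrite big1 ?subr0// => i _; rewrite mxE scale0r.
pose K := \sum_(i < n.+1) N (b i).
have NL c : N (L c) <= K * `|c|.
  rewrite /L /K mulr_suml.
  apply: (@le_trans _ _ (\sum_(i < n.+1) N (c 0 i *: b i))).
    elim/big_ind2 : _ => // [|x y z t xy zt]; first by rewrite N0.
    by apply: le_trans (N_triangle _ _) _; exact: lerD.
  apply: ler_sum => i _; rewrite N_scale mulrC ler_wpM2l//.
  exact: ler_coord_norm.
pose q (x : V) := inf [set N (x - y) | y in H].
have lbq x : has_lbound [set N (x - y) | y in H].
  by exists 0 => _ [y _ <-].
have q_le x y : H y -> q x <= N (x - y).
  by move=> Hy; apply: ge_inf => //; exists y.
have q_tri x y : q x <= q y + N (x - y).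
  rewrite -lerBlDr; apply: lb_le_inf.
    by exists (N (y - 0)), 0.
  move=> _ [z Hz <-]; rewrite lerBlDr.
  apply: le_trans (q_le x z Hz) _.
  rewrite [leRHS]addrC; apply: le_trans (N_triangle _ _).
  by rewrite addrA subrK.
have q_gt0 x : ~ H x -> 0 < q x.
  move=> Hx; have [e He eq] := prox x Hx.
  rewrite /q -eq lt_neqAle N_ge0 andbT; apply/negP => /eqP/esym/N_eq0/eqP.
  by rewrite subr_eq0 => /eqP xe; apply: Hx; rewrite xe.
have fD x y : f (x + y) = f x + f y.
  by have := flin 1 x y; rewrite scale1r mul1r.
have fZ t x : f (t *: x) = t * f x by exact: scalar_scale.
have fB x y : f (x - y) = f x - f y by rewrite fD -(scaleN1r y) fZ mulN1r.
have QcL c d : `|q (L c) - q (L d)| <= K * `|c - d|.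
  rewrite ler_norml lerBlDr lerNl opprB lerBlDr; apply/andP; split.
    rewrite addrC; apply: le_trans (q_tri _ (L c)) _; rewrite lerD2l -LB.
    by apply: le_trans (NL _) _; rewrite distrC.
  by rewrite addrC; apply: le_trans (q_tri _ (L d)) _; rewrite lerD2l -LB NL.
have FcL c d : `|f (L c) - f (L d)| <= (\sum_(i < n.+1) `|f (b i)|) * `|c - d|.
  rewrite -fB -LB mulr_suml.
  have -> : f (L (c - d)) = \sum_(i < n.+1) (c - d) 0 i * f (b i).
    rewrite /L; elim/big_ind2 : _ => // [|x y z t <- <-//].
    exact: scalar_at0.
  apply: le_trans (ler_norm_sum _ _ _) _; apply: ler_sum => i _.
  by rewrite normrM mulrC ler_wpM2l// ler_coord_norm.
have Qcont := lipschitz_continuous_real QcL.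
have Fcont := lipschitz_continuous_real FcL.
pose S : set 'rV[R]_n.+1 := [set c | `|c| = 1].
have S0 : S !=set0.
  exists (const_mx 1); rewrite /S /=.
  rewrite /Num.norm /= mx_normrE; apply/eqP; rewrite eq_le; apply/andP; split.
    by apply/bigmax_leP; split => // i _; rewrite mxE normr1.
  by apply/bigmax_geP; right; exists (0, 0) => //=; rewrite mxE normr1.
have S_compact : compact S.
  apply: bounded_closed_compact.
    by exists 1; split => // M M1 c /= ->; exact: ltW.
  have -> : S = Num.norm @^-1` [set 1] by [].
  apply: closed_comp => [c _|]; last exact: closed_eq.
  exact: norm_continuous.
have SH c : S c -> ~ H (L c).
  move=> Sc /L_inj c0; move: Sc; rewrite /S /= c0 normr0 => /esym/eqP.
  by rewrite oner_eq0.
pose G c := f (L c) / q (L c).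
have Gcont : {within S, continuous G}.
  apply: continuous_in_subspaceT => c /set_mem Sc.
  have qc0 : q (L c) != 0 by rewrite gt_eqF// q_gt0//; exact: SH.
  exact: (cvgM (Fcont c) (cvgV qc0 (Qcont c))).
have [c /set_mem Sc Gmax] := EVT_max_rV S0 S_compact Gcont.
have qc0 : 0 < q (L c) by apply: q_gt0; exact: SH.
have [e He qe] := prox _ (SH _ Sc).
exists ((q (L c))^-1 *: (L c - e)); split.
  by rewrite N_scale qe ger0_norm ?invr_ge0 1?ltW// mulVf ?gt_eqF.
rewrite fZ fB (fH _ He) subr0 mulrC => z.
rewrite -/(G c).
(* The sphere is symmetric, and c |-> - c changes the sign of f and not that of
   q; so the maximum is nonnegative. *)
have G0 : 0 <= G c.
  have Snc : S (- c) by rewrite /S /= normrN.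
  have LN : L (- c) = - L c by rewrite -(scaleN1r c) LZ scaleN1r.
  have qN0 : 0 < q (L (- c)) by apply: q_gt0; exact: SH.
  have fN : f (L (- c)) = - f (L c) by rewrite LN -(scaleN1r (L c)) fZ mulN1r.
  have [//|Gneg] := leP 0 (G c).
  have := Gmax _ (mem_set Snc).
  rewrite /G fN; apply: contraTT => _; rewrite -ltNge.
  have fneg : f (L c) < 0 by move: Gneg; rewrite /G pmulr_llt0 ?invr_gt0.
  by apply: (lt_trans Gneg); apply: divr_gt0 => //; rewrite oppr_gt0.
have [d [Hd _]] := bH z; rewrite -/(L d) in Hd.
have [d0|d0] := eqVneq d 0.
  suff -> : f z = 0 by exact: mulr_ge0.
  apply: fH; move: Hd; rewrite d0 /L big1 ?subr0// => i _.
  by rewrite mxE scale0r.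
have nd0 : 0 < `|d| by rewrite normr_gt0.
pose d' := `|d|^-1 *: d.
have Sd' : S d'.
  by rewrite /S /= normrZ ger0_norm ?invr_ge0// mulVf ?gt_eqF.
have dE : d = `|d| *: d' by rewrite scalerA mulfV ?gt_eqF// scale1r.
have fz : f z = `|d| * f (L d').
  by rewrite -fZ -LZ -dE -[z in LHS](subrK (L d)) fD fH ?add0r.
have fGq : f (L d') = G d' * q (L d').
  by rewrite /G divfK// gt_eqF// q_gt0//; exact: SH.
(* z / |d| and L d' differ by an element of H. *)
have qd' : `|d| * q (L d') <= N z.
  have : q (L d') <= N (L d' - (- `|d|^-1) *: (z - L d)).
    by apply: q_le; exact: HZ.
  have -> : L d' - (- `|d|^-1) *: (z - L d) = `|d|^-1 *: z.
    by rewrite /d' LZ scaleNr opprK scalerBr addrC subrK.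
  rewrite N_scale ger0_norm ?invr_ge0// => le.
  rewrite -(ler_pM2l (_ : 0 < `|d|^-1)) ?invr_gt0// mulrA.
  by rewrite mulVf ?gt_eqF// mul1r.
rewrite fz fGq mulrCA.
apply: (@le_trans _ _ (G c * (`|d| * q (L d')))); last exact: ler_wpM2l.
apply: ler_wpM2r; last exact/Gmax/mem_set.
by rewrite mulr_ge0//; apply/ltW/q_gt0/SH.
Qed.

End proximinal_finite_codim.

(** * The space c0 *)

Section c0_space.
Variable R : realType.
Implicit Types x y : c0 R.

Lemma c0_cvg x : x n @[n --> \oo] --> (0 : R).
Proof. by case: x => x /= /set_mem. Qed.

Lemma c0_addE x y n : (x + y) n = x n + y n. Proof. by []. Qed.
Lemma c0_scaleE t x n : (t *: x) n = t * x n. Proof. by []. Qed.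

Lemma c0_eq x y : (forall n, x n = y n) -> x = y.
Proof. by move=> xy; apply: val_inj; apply/funext. Qed.

Lemma c0_neq0 x : x != 0 -> exists n, x n != 0.
Proof.
move=> x0; apply: contrapT => nx; move/eqP: x0; apply; apply: c0_eq => n.
by apply/eqP/negPn/negP => xn; apply: nx; exists n.
Qed.

Lemma c0_has_ubound x : has_ubound (range (fun n => `|x n|)).
Proof.
have : cvgn (fun n => x n) by apply/cvg_ex; exists 0; exact: c0_cvg.
move=> /cvg_seq_bounded [M [_ /(_ (M + 1))]]; rewrite ltrDl ltr01 => /(_ isT) h.
by exists (M + 1) => _ [n _ <-]; exact: h.
Qed.

Lemma le_sup_norm x n : `|x n| <= sup_norm x.
Proof. by apply: ub_le_sup; [exact: c0_has_ubound|exists n]. Qed.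

Lemma sup_norm_le x B : (forall n, `|x n| <= B) -> sup_norm x <= B.
Proof.
move=> xB; apply: ge_sup; first by exists `|x 0|, 0%N.
by move=> _ [n _ <-].
Qed.

Lemma sup_norm_ge0 x : 0 <= sup_norm x.
Proof. exact: le_trans (le_sup_norm x 0). Qed.

Lemma c0_unit_subproof p : (fun n => (n == p)%:R : R) \in @c0_pred R.
Proof.
apply/mem_set => /=; apply: cvg_near_cst; near=> n.
by rewrite gtn_eqF//; near: n; exact: nbhs_infty_gt.
Unshelve. all: by end_near. Qed.

Definition c0_unit p : c0 R := C0 (c0_unit_subproof p).

Lemma not_proportional x x' : x != 0 ->
  (forall t, x' != t *: x) -> exists i k, x i * x' k - x k * x' i != 0.
Proof.
move=> x0 xx'; apply: contrapT => nE.
have [i xi0] := c0_neq0 x0.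
move/eqP: (xx' (x' i / x i)); apply; apply: c0_eq => k; rewrite c0_scaleE.
have [d0|d0] := eqVneq (x i * x' k - x k * x' i) 0;
  last by case: nE; exists i, k.
apply: (mulfI xi0); move/eqP: d0; rewrite subr_eq0 => /eqP ->.
by field.
Qed.

End c0_space.

Lemma series_eventually0 (R : realType) (w : nat -> R) K :
  (forall n, (K <= n)%N -> w n = 0) ->
  limn (series w) = \sum_(0 <= n < K) w n.
Proof.
move=> w0; apply: lim_near_cst => //; near=> n.
rewrite /series /= (@big_cat_nat _ _ _ K)//=; last first.
  by near: n; exact: nbhs_infty_ge.
rewrite [X in _ + X]big1_seq ?addr0// => i.
by rewrite mem_index_iota => /andP[_ /andP[/w0]].
Unshelve. all: by end_near. Qed.

Lemma sum_delta (R : realType) (F : nat -> R) p m : (p < m)%N ->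
  \sum_(0 <= n < m) (n == p)%:R * F n = F p.
Proof.
move=> pm; rewrite big_mkord (bigD1 (Ordinal pm))//= eqxx mul1r big1 ?addr0//.
by move=> i ip; rewrite (_ : (i == p :> nat) = false) ?mul0r//; apply: negbTE.
Qed.

(** * Rational functionals of finite support *)

Lemma infinite_set_near (A : set nat) (Q : nat -> Prop) :
  infinite_set A -> (\forall n \near \oo, Q n) -> exists2 n, A n & Q n.
Proof.
move=> Ainf [K _ QK]; apply: contrapT => nAQ; apply: Ainf.
apply: (sub_finite_set _ (finite_II K)) => n An /=.
by rewrite ltnNge; apply/negP => Kn; apply: nAQ; exists n => //; exact: QK.
Qed.

Lemma rat_approx (R : realType) (r e : R) : 0 < e ->
  exists q : rat, `|ratr q - r| < e.
Proof.
move=> e0; have [q] : exists q : rat, ratr q \in `]r - e, r + e[.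
  by apply: rat_in_itvoo; lra.
by rewrite in_itv /= => /andP[? ?]; exists q; rewrite ltr_norml; lra.
Qed.

Lemma pairing_three_points (R : realType) (y : nat -> R) i k l (p q r : rat) :
  pairing y (seq_of_c00Q R [fsfun n in [fset i; k; l]%fset =>
    (n == i)%:R * p + (n == k)%:R * q + (n == l)%:R * r]) =
  ratr p * y i + ratr q * y k + ratr r * y l.
Proof.
set w := [fsfun n in _ => _].
have wE n : w n = (n == i)%:R * p + (n == k)%:R * q + (n == l)%:R * r.
  rewrite fsfunE !inE.
  case: (n == i); case: (n == k); case: (n == l) => //=.
  by rewrite !mul0r !addr0.
rewrite /pairing (@series_eventually0 _ _ (i + k + l).+1) => [|n nikl /=];
  last first.
  by rewrite /seq_of_c00Q wE !gtn_eqF ?mul0r ?addr0 ?raddf0 ?mulr0//; lia.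
have E n : y n * seq_of_c00Q R w n = (n == i)%:R * (ratr p * y n) +
    (n == k)%:R * (ratr q * y n) + (n == l)%:R * (ratr r * y n).
  rewrite /seq_of_c00Q wE !rmorphD !rmorphM !rmorph_nat /=; ring.
rewrite (eq_bigr _ (fun n _ => E n)).
rewrite !big_split /=.
by rewrite !(@sum_delta _ (fun n => ratr _ * y n)) //; lia.
Qed.

(** Linear independence of x and x' shows in two coordinates i and k, so a real
    combination of e_i and e_k takes any prescribed values on x and x'.  It is
    then replaced by a nearby rational one; a small rational multiple of e_l
    is added if this vanishes on x''. *)
Lemma exists_rational_functional (R : realType) (x x' x'' : nat -> R)
    i k l s s' e :
  x i * x' k - x k * x' i != 0 -> x'' l != 0 -> 0 < e ->
  exists w : c00Q, [/\ `|pairing x (seq_of_c00Q R w) - s| < e,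
    `|pairing x' (seq_of_c00Q R w) - s'| < e &
    pairing x'' (seq_of_c00Q R w) != 0].
Proof.
move=> det0 xl0 e0; set det := x i * x' k - x k * x' i in det0.
(* Cramer's rule for the coefficients of e_i and e_k. *)
pose al := (s * x' k - s' * x k) / det; pose be := (s' * x i - s * x' i) / det.
have als : al * x i + be * x k = s by rewrite /al /be /det; field.
have als' : al * x' i + be * x' k = s' by rewrite /al /be /det; field.
pose B := 1 + `|x i| + `|x k| + `|x l| + `|x' i| + `|x' k| + `|x' l|.
have B0 : 0 < B by rewrite /B !ltr_wpDr.
pose eta := e / B.
have eta0 : 0 < eta by exact: divr_gt0.
have [p pal] := rat_approx al eta0.
have [q qbe] := rat_approx be eta0.
have [r re r0] : exists2 r : rat, `|ratr r : R| < eta &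
    ratr p * x'' i + ratr q * x'' k + ratr r * x'' l != 0.
  have [z|nz] := eqVneq (ratr p * x'' i + ratr q * x'' k) 0; last first.
    by exists 0; rewrite raddf0 ?normr0// mul0r addr0.
  have [r] := rat_in_itvoo eta0; rewrite in_itv /= => /andP[r0 r1].
  by exists r; rewrite ?gtr0_norm// z add0r mulf_neq0// gt_eqF.
exists [fsfun n in [fset i; k; l]%fset =>
    (n == i)%:R * p + (n == k)%:R * q + (n == l)%:R * r].
have close (y : nat -> R) t : al * y i + be * y k = t ->
    `|y i| + `|y k| + `|y l| < B ->
    `|ratr p * y i + ratr q * y k + ratr r * y l - t| < e.
  move=> <- yB.
  rewrite (_ : _ - _ = (ratr p - al) * y i + (ratr q - be) * y k +
    ratr r * y l); last by ring.
  apply: (@le_lt_trans _ _ (eta * (`|y i| + `|y k| + `|y l|))).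
    rewrite !mulrDr; apply: le_trans (ler_normD _ _) _; apply: lerD.
      apply: le_trans (ler_normD _ _) _; apply: lerD.
    1-3: by rewrite normrM ler_wpM2r// ltW.
  by rewrite -[e](divfK (lt0r_neq0 B0)) -/eta ltr_pM2l.
have nn (y : nat -> R) m : 0 <= `|y m| by [].
rewrite !pairing_three_points; split => //; apply: close => //; rewrite /B.
  by move: (nn x i) (nn x k) (nn x l) (nn x' i) (nn x' k) (nn x' l); lra.
by move: (nn x i) (nn x k) (nn x l) (nn x' i) (nn x' k) (nn x' l); lra.
Qed.

(** * The renorming of c0 *)

Section read_norm_theory.
Variables (R : realType) (u : nat -> c00Q) (a : nat -> nat).
Hypothesis a_incr : forall i j : nat, (i < j)%N -> (a i < a j)%N.
Hypothesis a_pos : forall k : nat, (0 < a k)%N.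
Hypothesis a_supp : forall k : nat, u k <> [fsfun] -> (max_supp (u k) < a k)%N.
Hypothesis a_norm : forall k : nat, u k <> [fsfun] ->
  l1_norm (seq_of_c00Q R (u k)) <= (a k)%:R.

Let N (x : c0 R) : R := read_norm u a x.
Let uR k : nat -> R := seq_of_c00Q R (u k).
Let v k : nat -> R := uR k - unit_vec R (a k).
Let weight k : R := 2 ^- (a k ^ 2).
(* Sequences start at index 0, so e_(a_k) has its nonzero entry at a_k - 1. *)
Let pos k : nat := (a k).-1.

Lemma uR_eq0 k n : ((a k).-1 <= n)%N -> uR k n = 0.
Proof.
move=> akn; rewrite /uR /seq_of_c00Q.
have [->|/eqP uk0] := eqVneq (u k) [fsfun]; first by rewrite fsfunE raddf0.
have [nu|nu] := boolP (n \in finsupp (u k)); last by rewrite fsfun_dflt ?raddf0.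
have : (n.+1 <= max_supp (u k))%N.
  by rewrite /max_supp (big_rem n)//= leq_maxl.
by move: (a_supp uk0) (a_pos k); lia.
Qed.

Lemma pos_lt k : (pos k < a k)%N. Proof. by rewrite /pos prednK. Qed.

Lemma le_pos k : (k <= pos k)%N.
Proof.
elim: k => // k IH; rewrite /pos.
by have := @a_incr k k.+1 (ltnSn k); move: IH (a_pos k); rewrite /pos; lia.
Qed.

Lemma a_growth j k : (j <= k)%N -> (a j + (k - j) <= a k)%N.
Proof.
elim: k => [|k IH]; first by rewrite leqn0 => /eqP ->; lia.
rewrite leq_eqVlt => /predU1P[->|jk]; first by lia.
by have := @a_incr k k.+1 (ltnSn k); have := IH jk; lia.
Qed.

Lemma vE k n : v k n = uR k n - (n == pos k)%:R.
Proof.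
rewrite /v /unit_vec /pos; congr (_ - _%:R).
by have := a_pos k; case: (a k).
Qed.

Lemma pairing_uE (x : nat -> R) k :
  pairing x (uR k) = \sum_(0 <= n < a k) x n * uR k n.
Proof.
apply: (@series_eventually0 _ (fun n => x n * uR k n)) => n akn.
rewrite uR_eq0 ?mulr0//.
exact: leq_trans (leq_pred _) akn.
Qed.

Lemma pairing_vE (x : nat -> R) k :
  pairing x (v k) = \sum_(0 <= n < a k) x n * v k n.
Proof.
apply: (@series_eventually0 _ (fun n => x n * v k n)) => n akn.
rewrite vE uR_eq0; last first.
  exact: leq_trans (leq_pred _) akn.
by rewrite gtn_eqF ?subr0 ?mulr0// (leq_trans (pos_lt k)).
Qed.

Lemma pairing_vDZ (x y : nat -> R) t k :
  pairing (x + t *: y) (v k) = pairing x (v k) + t * pairing y (v k).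
Proof.
rewrite !pairing_vE mulr_sumr -big_split /=; apply: eq_bigr => i _.
by rewrite mulrDl -mulrA.
Qed.

Lemma pairing_v_u (x : nat -> R) k :
  pairing x (v k) = pairing x (uR k) - x (pos k).
Proof.
rewrite pairing_vE pairing_uE.
under eq_bigr do rewrite vE mulrBr.
rewrite sumrB; congr (_ - _); under eq_bigr do rewrite mulrC.
exact: sum_delta (pos_lt k).
Qed.

Lemma pairing_unit p k : pairing (c0_unit R p) (v k) = v k p.
Proof.
rewrite pairing_vE; have [pk|kp] := ltnP p (a k); first exact: sum_delta.
rewrite vE uR_eq0 ?(leq_trans (leq_pred _))//.
rewrite gtn_eqF ?(leq_trans (pos_lt k))// subrr.
rewrite big1_seq// => i; rewrite mem_index_iota => /andP[_ /= ik].
by rewrite ltn_eqF ?mul0r// (leq_trans ik).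
Qed.

Lemma sum_uR_le k : \sum_(0 <= n < a k) `|uR k n| <= (a k)%:R.
Proof.
have [uk0|/eqP uk0] := eqVneq (u k) [fsfun].
  by rewrite big1 // => n _; rewrite /uR uk0 /seq_of_c00Q fsfunE raddf0 normr0.
rewrite -(@series_eventually0 _ (fun n => `|uR k n|)); first exact: a_norm.
by move=> n akn; rewrite uR_eq0 ?normr0// (leq_trans (leq_pred _)).
Qed.

Lemma uR_le k n : `|uR k n| <= (a k)%:R.
Proof.
have [nk|kn] := ltnP n (a k).
  apply: le_trans (sum_uR_le k).
  rewrite big_mkord (bigD1 (Ordinal nk))//= lerDl.
  exact: sumr_ge0.
by rewrite uR_eq0 ?normr0// (leq_trans (leq_pred _)).
Qed.

Lemma pairing_v_le (x : c0 R) k :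
  `|pairing x (v k)| <= sup_norm x * (a k).+1%:R.
Proof.
rewrite pairing_v_u -addn1 natrD mulrDr mulr1.
apply: le_trans (ler_normB _ _) _; apply: lerD; last exact: le_sup_norm.
rewrite pairing_uE; apply: le_trans (ler_norm_sum _ _ _) _.
apply: (@le_trans _ _ (sup_norm x * \sum_(0 <= n < a k) `|uR k n|)).
  rewrite mulr_sumr; apply: ler_sum => i _.
  by rewrite normrM ler_wpM2r// le_sup_norm.
by rewrite ler_wpM2l ?sup_norm_ge0// sum_uR_le.
Qed.

Lemma weight_gt0 k : 0 < weight k.
Proof. by rewrite /weight invr_gt0 exprn_gt0. Qed.

Let summand (x : nat -> R) k : R := weight k * `|pairing x (v k)|.

Lemma summand_ge0 (x : nat -> R) k : 0 <= summand x k.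
Proof. by rewrite /summand mulr_ge0// ltW// weight_gt0. Qed.

Lemma natr_le_expr2 n : n%:R <= 2 ^+ n :> R.
Proof. by rewrite -natrX ler_nat ltnW// ltn_expl. Qed.

(** The series defining the norm converges because a_k + 1 <= 2^(a_k), which is
    absorbed by 2^(-a_k^2), and a_k > k. *)
Lemma summand_le (x : c0 R) k :
  summand x k <= geometric (sup_norm x * 2) 2^-1 k.
Proof.
rewrite /summand /geometric /=.
apply: (@le_trans _ _ (weight k * (sup_norm x * (a k).+1%:R))).
  by apply: ler_wpM2l (pairing_v_le _ _); rewrite ltW// weight_gt0.
rewrite mulrCA -mulrA ler_wpM2l ?sup_norm_ge0//.
rewrite /weight mulrC ler_pdivrMr ?exprn_gt0//.
apply: le_trans (natr_le_expr2 _) _.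
rewrite exprVn -(ler_pM2r (_ : 0 < 2 ^+ k)) ?exprn_gt0//.
rewrite [leRHS]mulrAC divfK ?expf_neq0// -exprD -exprS ler_eXn2l ?ltr1n//.
by have := pos_lt k; have := le_pos k; nia.
Qed.

Lemma summand_cvg (x : c0 R) : cvgn (series (summand x)).
Proof.
apply: (series_le_cvg (summand_ge0 x) _ (summand_le x)).
  by move=> n; apply: le_trans (summand_le x n); exact: summand_ge0.
by apply: is_cvg_geometric_series; rewrite ger0_norm// invf_lt1// ltr1n.
Qed.

Lemma series_summand_le (x : c0 R) n :
  series (summand x) n <= limn (series (summand x)).
Proof.
apply: nondecreasing_cvgn_le; last exact: summand_cvg.
by apply: nondecreasing_series => *; exact: summand_ge0.
Qed.

Lemma read_normE (x : c0 R) : N x = sup_norm x + limn (series (summand x)).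
Proof. by []. Qed.

(** Comparison of two norms by a majorant w of the differences of their
    summands.  Only an eventual bound on the partial sums of w is asked, since
    w may change sign. *)
Lemma read_norm_le_add (x y : c0 R) (w : nat -> R) B E :
  sup_norm x <= sup_norm y + E ->
  (forall k, summand x k <= summand y k + w k) ->
  (\forall n \near \oo, series w n <= B) ->
  N x <= N y + (E + B).
Proof.
move=> xy txy wB; rewrite !read_normE addrACA lerD//.
apply: limr_le; first exact: summand_cvg.
near=> n; apply: (@le_trans _ _ (series (summand y) n + series w n)).
  by rewrite /series /= -big_split; apply: ler_sum => i _; exact: txy.
by apply: lerD; [exact: series_summand_le|near: n].
Unshelve. all: by end_near. Qed.

Lemma read_norm_triangle (x y : c0 R) : N (x + y) <= N x + N y.
Proof.
rewrite [N y]read_normE; apply: (@read_norm_le_add _ _ (summand y)).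
- apply: sup_norm_le => n; rewrite c0_addE.
  by apply: le_trans (ler_normD _ _) _; apply: lerD; exact: le_sup_norm.
- move=> k; rewrite /summand -mulrDr ler_wpM2l ?(ltW (weight_gt0 k))//.
  by rewrite -[y in (x + y)]scale1r pairing_vDZ mul1r ler_normD.
- by near=> n; exact: series_summand_le.
Unshelve. all: by end_near. Qed.

Lemma read_norm_ge0 (x : c0 R) : 0 <= N x.
Proof.
rewrite read_normE addr_ge0 ?sup_norm_ge0//.
by apply: le_trans (series_summand_le x 0%N); rewrite /series /= big_geq.
Qed.

Lemma read_norm_eq0 (x : c0 R) : N x = 0 -> x = 0.
Proof.
move=> Nx; apply: c0_eq => n; apply/eqP.
rewrite -normr_eq0 eq_le normr_ge0 andbT.
apply: le_trans (le_sup_norm x n) _; rewrite -Nx read_normE lerDl.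
by apply: le_trans (series_summand_le x 0%N); rewrite /series /= big_geq.
Qed.

Lemma read_norm_scale_le t (x : c0 R) : N (t *: x) <= `|t| * N x.
Proof.
rewrite read_normE mulrDr lerD//.
  apply: sup_norm_le => n; rewrite c0_scaleE normrM ler_wpM2l//.
  exact: le_sup_norm.
apply: limr_le; first exact: summand_cvg.
near=> n; rewrite /series /=.
apply: (@le_trans _ _ (`|t| * series (summand x) n)).
  rewrite /series mulr_sumr /=; apply: ler_sum => k _; rewrite /summand.
  have -> : pairing (t *: x) (v k) = t * pairing x (v k).
    rewrite !pairing_vE mulr_sumr; apply: eq_bigr => i _.
    by rewrite -mulrA.
  by rewrite normrM mulrCA.
by rewrite ler_wpM2l// series_summand_le.
Unshelve. all: by end_near. Qed.

Lemma read_norm_scale t (x : c0 R) : N (t *: x) = `|t| * N x.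
Proof.
apply/eqP; rewrite eq_le read_norm_scale_le /=.
have [->|t0] := eqVneq t 0; first by rewrite normr0 mul0r read_norm_ge0.
rewrite -ler_pdivlMl ?normr_gt0// -normfV.
by apply: le_trans (read_norm_scale_le _ _); rewrite scalerA mulVf// scale1r.
Qed.

(** Summed over k > j, the right-hand sides give at most a quarter of the j-th
    weight, since 2^-3 + 2^-4 + ... = 1/4.  As a_k <= 2^(a_k), this amounts
    to a_k^2 - a_k >= a_j^2 + (k - j) + 2, which follows from
    a_k >= a_j + (k - j) and a_j >= 3. *)
Lemma weight_tail j k : (3 <= a j)%N -> (j < k)%N ->
  weight k * (a k)%:R <= weight j * 2 ^- (k - j + 2).
Proof.
move=> aj jk; rewrite /weight mulrC ler_pdivrMr ?exprn_gt0//.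
apply: le_trans (natr_le_expr2 _) _.
rewrite -invfM -exprD mulrC ler_pdivlMr ?exprn_gt0// -exprD ler_eXn2l ?ltr1n//.
have := a_growth (ltnW jk); have : (0 < k - j)%N by rewrite subn_gt0.
by move: (k - j)%N => i i0; move: (a k) (a j) aj => A B B3 AB; nia.
Qed.

(** * Perturbation of a vector along a unit vector *)

Section bump.
Variables (j : nat) (s t : R).

(* Bound for the change of the k-th summand when s e_(a_j) is added: v_k
   vanishes at the index a_j for k < j, equals - 1 there for k = j, and is at
   most a_k there in absolute value for k > j. *)
Let bump_bound k : R :=
  if (k < j)%N then 0 else if k == j then - (s * t * weight j)
  else `|s| * (weight j * 2 ^- (k - j + 2)).

Lemma series_bump_bound m :
  series bump_bound (j + m.+1)%N =
  - (s * t * weight j) + `|s| * weight j / 4 - `|s| * weight j * 2 ^- m.+2.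
Proof.
elim: m => [|m IH].
  rewrite addn1 /series /= big_nat_recr//= big1_seq; last first.
    move=> i; rewrite mem_index_iota => /andP[_ /= ij].
    by rewrite /bump_bound ij.
  by rewrite /bump_bound ltnn eqxx add0r; lra.
have -> : series bump_bound (j + m.+2)%N =
    series bump_bound (j + m.+1)%N + bump_bound (j + m.+1)%N.
  by rewrite addnS /series /= big_nat_recr.
rewrite IH.
rewrite /bump_bound ifF; last by apply/negbTE; rewrite -leqNgt leq_addr.
rewrite ifF; last by apply/negbTE; rewrite neq_ltn addnS ltnS leq_addr orbT.
rewrite addKn addn2 !exprS.
by field; rewrite expf_neq0.
Qed.

(** The second hypothesis says that t is the sign of <x, v_j> and that s is too
    small to change it; the third one that the perturbation stays below the sup
    norm of x, which is therefore not increased. *)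
Lemma read_norm_bump (x : c0 R) : (3 <= a j)%N ->
  `|pairing x (v j) - s| = `|pairing x (v j)| - s * t ->
  `|x (pos j)| + `|s| <= sup_norm x ->
  N (x + s *: c0_unit R (pos j)) <=
    N x + (- (s * t * weight j) + `|s| * weight j / 4).
Proof.
move=> aj pjs xs.
rewrite -[X in N x + X]add0r; apply: (@read_norm_le_add _ _ bump_bound).
- rewrite addr0; apply: sup_norm_le => n; rewrite c0_addE c0_scaleE /=.
  have [->|_] := eqVneq n (pos j); last by rewrite mulr0 addr0 le_sup_norm.
  by rewrite mulr1; apply: le_trans xs; exact: ler_normD.
- move=> k; rewrite /summand pairing_vDZ pairing_unit vE /bump_bound.
  case: ltngtP => [kj|jk|->].
  + rewrite uR_eq0 ?gtn_eqF ?subrr ?mulr0 ?addr0//.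
      by have := a_incr kj; have := a_pos k; rewrite /pos; lia.
    by have := a_incr kj; have := a_pos k; rewrite /pos; lia.
  + rewrite ltn_eqF ?subr0; last first.
      by have := a_incr jk; have := a_pos j; rewrite /pos; lia.
    rewrite -lerBlDl -mulrBr.
    apply: (@le_trans _ _ (weight k * (`|s| * (a k)%:R))).
      rewrite ler_wpM2l ?(ltW (weight_gt0 _))// lerBlDl.
      apply: le_trans (ler_normD _ _) _; rewrite lerD2l normrM ler_wpM2l//.
      exact: uR_le.
    by rewrite mulrCA ler_wpM2l// weight_tail.
  + by rewrite eqxx uR_eq0// sub0r mulrN1 pjs; lra.
- near=> n.
  have -> : n = (j + (n - j.+1).+1)%N.
    suff : (j < n)%N by lia.
    by near: n; exact: nbhs_infty_gt.
  rewrite series_bump_bound gerBl mulr_ge0 ?mulr_ge0 ?(ltW (weight_gt0 _))//.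
Unshelve. all: by end_near. Qed.

End bump.

(** With e = e_(a_j), the inequality f (x + s e) <= f x * N (x + s e) and the
    bound of [read_norm_bump] estimate s * f e from above; small s of both signs
    then bound f e from both sides. *)
Lemma norming_coordinate (f : c0 R -> R) (x : c0 R) j :
  scalar f -> attains_norm N f x -> (3 <= a j)%N ->
  pairing x (v j) != 0 -> `|x (pos j)| < sup_norm x ->
  `|f (c0_unit R (pos j)) + f x * weight j * Num.sg (pairing x (v j))|
    <= f x * weight j / 4.
Proof.
move=> flin [Nx1 fN] aj pj0 xj.
set e := c0_unit R (pos j); set P := pairing x (v j) in pj0 *.
pose d := Num.min `|P| (sup_norm x - `|x (pos j)|).
have d0 : 0 < d by rewrite lt_min normr_gt0 pj0 subr_gt0.
have dP : d <= `|P| by rewrite ge_min lexx.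
have dx : `|x (pos j)| + d <= sup_norm x by rewrite -lerBrDl ge_min lexx orbT.
have fx0 : 0 <= f x.
  by apply: (attains_norm_ge0 (N := N)) => //; exact: read_norm_scale.
have key s : `|s| = d ->
    s * f e <= f x * (- (s * Num.sg P * weight j) + `|s| * weight j / 4).
  move=> sd.
  have bump : N (x + s *: e) <=
      1 + (- (s * Num.sg P * weight j) + `|s| * weight j / 4).
    rewrite -[X in _ <= X + _]Nx1; apply: read_norm_bump => //;
      last by rewrite sd.
    rewrite -/P; move: dP; rewrite -sd ler_norml.
    case: (ltrgt0P P) pj0 => // P0 _.
      by rewrite gtr0_sg // mulr1 => /andP[_ ?]; rewrite ger0_norm ?subr_ge0.
    by rewrite ltr0_sg // mulrN1 => /andP[? _]; rewrite ler0_norm; lra.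
  have := fN (x + s *: e); rewrite addrC flin => /le_trans.
  move=> /(_ (f x * (1 + (- (s * Num.sg P * weight j) + `|s| * weight j / 4)))).
  rewrite [s *: e + x]addrC ler_wpM2l// => /(_ isT).
  by rewrite mulrDr mulr1 addrC lerD2l.
have := key d (ger0_norm (ltW d0)); have := key (- d).
rewrite !normrN (ger0_norm (ltW d0)) => /(_ erefl) h1 h2.
rewrite ler_norml -(ler_pM2l d0) -[X in _ && X](ler_pM2l d0).
by apply/andP; split; lra.
Qed.

(** When u_j = w, the number <x, v_j> differs from <x, w> by the coordinate of
    x of index a_j, which tends to 0; so it eventually has the same sign. *)
Lemma norming_coordinate_near (f : c0 R -> R) (x : c0 R) (w : c00Q) :
  scalar f -> attains_norm N f x -> pairing x (seq_of_c00Q R w) != 0 ->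
  \forall j \near \oo, u j = w ->
    `|f (c0_unit R (pos j)) +
        f x * weight j * Num.sg (pairing x (seq_of_c00Q R w))|
      <= f x * weight j / 4.
Proof.
move=> flin fN; set P := pairing _ _ => P0.
have sx0 : 0 < sup_norm x.
  rewrite lt_neqAle sup_norm_ge0 andbT; apply: contraNneq P0 => sx0.
  apply/eqP; rewrite /P /pairing (@series_eventually0 _ _ 0%N) ?big_geq//.
  move=> n _ /=.
  suff -> : x n = 0 by rewrite mul0r.
  by apply/eqP; rewrite -normr_eq0 eq_le normr_ge0 andbT sx0 le_sup_norm.
have m0 : 0 < Num.min `|P| (sup_norm x) by rewrite lt_min normr_gt0 P0.
have /cvgr0Pnorm_lt/(_ _ m0)[K _ xK] := @c0_cvg _ x.
near=> j => ujw.
have : `|x (pos j)| < Num.min `|P| (sup_norm x).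
  apply: xK => /=; apply: leq_trans (le_pos j).
  by near: j; exact: nbhs_infty_ge.
rewrite lt_min => /andP[xP xs].
have Pj : pairing x (v j) = P - x (pos j) by rewrite pairing_v_u /uR ujw.
have sgP : Num.sg (pairing x (v j)) = Num.sg P.
  rewrite Pj; move: xP; rewrite ltr_norml => /andP[].
  have [P_gt0|P_lt0|P_eq0] := ltrgt0P P; last by rewrite P_eq0 eqxx in P0.
    by move=> _ ?; rewrite !gtr0_sg// subr_gt0.
  by move=> ? _; rewrite !ltr0_sg// subr_lt0; lra.
rewrite -sgP; apply: norming_coordinate => //; last first.
  by rewrite -sgr_eq0 sgP sgr_eq0.
apply: leq_ltn_trans (pos_lt j); apply: leq_trans (le_pos j).
by near: j; exact: nbhs_infty_ge.
Unshelve. all: by end_near. Qed.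

Hypothesis u_lists : forall w : c00Q, infinite_set [set k | u k = w].

(** The three estimates of [norming_coordinate_near] for f at x, g at x' and
    f + g at x'', taken at a common index j, turn prescribed signs of <x, w> and
    <x', w> into a constraint on the norm M of f + g.  Equal signs force
    2 - 2/4 <= M (1 + 1/4), opposite signs force M (1 - 1/4) <= 2/4. *)
Lemma norming_points_proportional (f g : c0 R -> R) (x x' x'' : c0 R) :
  scalar f -> scalar g ->
  attains_norm N f x -> f x = 1 -> attains_norm N g x' -> g x' = 1 ->
  attains_norm N (fun z => f z + g z) x'' ->
  exists t, x' = t *: x.
Proof.
move=> fl gl fA fx gA gx' hA; apply: contrapT => x'_ntx.
have neq0 y : N y = 1 -> y != 0.
  move=> Ny; apply/eqP => y0; have := read_norm_scale 0 y.
  by rewrite normr0 mul0r scale0r -y0 Ny => /eqP; rewrite oner_eq0.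
pose h z := f z + g z; rewrite -/h in hA.
have hl : scalar h by move=> t y z; rewrite /h fl gl /=; ring.
have hx0 : 0 <= h x'' := attains_norm_ge0 read_norm_scale hl hA.
have [i [k det0]] : exists i k, x i * x' k - x k * x' i != 0.
  apply: not_proportional; first by apply: neq0; case: fA.
  by move=> t; apply/eqP => x'E; apply: x'_ntx; exists t.
have [l x''l] : exists l, x'' l != 0.
  by apply: c0_neq0; apply: neq0; case: hA.
have dist1 r : `|r - 1| < 1 -> Num.sg r = 1 :> R.
  by rewrite ltr_norml => ?; apply: gtr0_sg; lra.
have distN1 r : `|r - - 1| < 1 -> Num.sg r = - 1 :> R.
  by rewrite ltr_norml => ?; apply: ltr0_sg; lra.
have values s : s = 1 \/ s = -1 -> exists C F G t : R, [/\ 0 < C,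
    `|F + C| <= C / 4, `|G + C * s| <= C / 4, `|t| = 1 &
    `|F + G + h x'' * C * t| <= h x'' * C / 4].
  move=> s1.
  have [w [wx wx' wx'']] := exists_rational_functional 1 s det0 x''l ltr01.
  have sgx := dist1 _ wx.
  have sgx' : Num.sg (pairing x' (seq_of_c00Q R w)) = s.
    by case: s1 wx' => -> ?; [exact: dist1|exact: distN1].
  have nx : pairing x (seq_of_c00Q R w) != 0 by rewrite -sgr_eq0 sgx oner_eq0.
  have nx' : pairing x' (seq_of_c00Q R w) != 0.
    by rewrite -sgr_eq0 sgx'; case: s1 => ->; rewrite ?oppr_eq0 oner_eq0.
  have Ef := norming_coordinate_near fl fA nx.
  have Eg := norming_coordinate_near gl gA nx'.
  have Eh := norming_coordinate_near hl hA wx''.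
  have [j ujw [] []] :=
    infinite_set_near (@u_lists w) (filterI (filterI Ef Eg) Eh).
  move=> /(_ ujw) Fj /(_ ujw) Gj /(_ ujw) Hj.
  move: Fj Gj; rewrite fx gx' sgx sgx' !mul1r mulr1 => Fj Gj.
  (* C is the weight of index j; F, G are the values of f, g on e_(a_j). *)
  exists (2 ^- (a j ^ 2)), (f (c0_unit R (a j).-1)), (g (c0_unit R (a j).-1)).
  exists (Num.sg (pairing x'' (seq_of_c00Q R w))); split => //.
  by rewrite normr_sg wx''.
have [C [F [G [t [C0 FC GC t1 HC]]]]] := values 1 (or_introl erefl).
have [C' [F' [G' [t' [C0' FC' GC' t1' HC']]]]] := values (-1) (or_intror erefl).
set M := h x'' in hx0 HC HC'.
have sgn (r : R) : `|r| = 1 -> r = 1 \/ r = -1.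
  by move=> /eqP; rewrite eqr_norml ler01 andbT => /orP[] /eqP ->; [left|right].
have M_le : M <= 2 / 3.
  have : M * C' <= 2 / 3 * C'.
    move: FC' GC' HC'; rewrite !ler_norml => /andP[? ?] /andP[? ?] /andP[? ?].
    by case: (sgn _ t1') => t'E; subst t'; lra.
  by rewrite ler_pM2r.
have M_ge : 6 / 5 <= M.
  have : 6 / 5 * C <= M * C.
    move: FC GC HC; rewrite !ler_norml => /andP[? ?] /andP[? ?] /andP[? ?].
    have : 0 <= M * C by rewrite mulr_ge0// ltW.
    by case: (sgn _ t1) => tE; subst t; lra.
  by rewrite ler_pM2r.
lra.
Qed.

End read_norm_theory.

Theorem theorem1p1 (R : realType) (u : nat -> c00Q) (a : nat -> nat)
    (u_lists : forall v : c00Q, infinite_set [set k | u k = v])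
    (a_incr : forall i j : nat, (i < j)%N -> (a i < a j)%N)
    (a_pos : forall k : nat, (0 < a k)%N)
    (a_supp : forall k : nat, u k <> [fsfun] -> (max_supp (u k) < a k)%N)
    (a_norm : forall k : nat, u k <> [fsfun] ->
       l1_norm (seq_of_c00Q R (u k)) <= (a k)%:R) :
  forall (n : nat) (H : set (c0 R)),
    (2 <= n)%N -> linear_subspace H -> has_codim H n ->
    ~ proximinal (fun x y : c0 R => read_norm u a (x - y)) H.
Proof.
move=> [|[|n]] // H _ Hlin [b bH] prox.
pose N (x : c0 R) := read_norm u a x.
have N_scale : forall t x, N (t *: x) = `|t| * N x by exact: read_norm_scale.
have attain (f : c0 R -> R) : scalar f -> (forall h, H h -> f h = 0) ->
    exists x, attains_norm N f x.
  apply: (@proximinal_attains_norm _ _ N _ _ _ H n.+1 b) => //.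
  - exact: read_norm_triangle.
  - exact: read_norm_eq0.
have attain1 (f : c0 R -> R) y :
    scalar f -> (forall h, H h -> f h = 0) -> f y != 0 ->
    exists m x, attains_norm N (fun z => m * f z) x /\ m * f x = 1.
  move=> fl fH fy; have [x fA] := attain f fl fH.
  have fx_gt0 := attains_norm_gt0 N_scale fl fA fy; have [Nx fx] := fA.
  exists (f x)^-1, x; rewrite mulVf ?gt_eqF//; split => //; split => // z.
  by rewrite mulVf ?gt_eqF// mul1r mulrC ler_pdivrMr// mulrC.
have [f0 [f0l f0H f0b]] := coordinate_functional ord0 Hlin bH.
have [g0 [g0l g0H g0b]] := coordinate_functional (lift ord0 ord0) Hlin bH.
have [m [x [fA fx]]] :
    exists m x, attains_norm N (fun z => m * f0 z) x /\ m * f0 x = 1.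
  by apply: (attain1 _ (b ord0)) => //; rewrite f0b oner_eq0.
pose f z := m * f0 z; rewrite -/f in fA; rewrite -/(f x) in fx.
have fl : scalar f by move=> t y z; rewrite /f f0l mulrDr mulrCA.
(* g1 vanishes at x, as f x = 1, but not on the second basis vector. *)
pose g1 z := g0 z - g0 x * f z.
have g1l : scalar g1 by move=> t y z; rewrite /g1 g0l fl; ring.
have [m' [x' [gA gx']]] :
    exists m' x', attains_norm N (fun z => m' * g1 z) x' /\ m' * g1 x' = 1.
  apply: (attain1 _ (b (lift ord0 ord0))) => //.
    by move=> h Hh; rewrite /g1 /f f0H// g0H// !mulr0 subr0.
  by rewrite /g1 /f f0b g0b eqxx /= !mulr0 subr0 oner_eq0.
pose g z := m' * g1 z; rewrite -/g in gA; rewrite -/(g x') in gx'.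
have gl : scalar g by move=> t y z; rewrite /g g1l mulrDr mulrCA.
have gx : g x = 0 by rewrite /g /g1 fx mulr1 subrr mulr0.
have [x'' hA] : exists x, attains_norm N (fun z => f z + g z) x.
  apply: attain => [t y z|y Hy]; first by rewrite fl gl /=; ring.
  by rewrite /g /g1 /f f0H// g0H// !mulr0 subr0 mulr0 addr0.
have [t x'E] : exists t, x' = t *: x.
  exact: (norming_points_proportional a_incr a_pos a_supp a_norm u_lists
            fl gl fA fx gA gx' hA).
by move/eqP: gx'; rewrite x'E scalar_scale// gx mulr0 eq_sym oner_eq0.
Qed.
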